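(* Let $\mathbf{w}=[w_0,w_1,\dots,w_{N-1}]^T\in\mathbb{C}^N$ with $\|\mathbf{w}\|_0=s$, where $s\geq 1$, and let $\hat{\mathbf{w}}\in\mathbb{C}^N$ (an approximation of $\mathbf{w}$). Let $q=\min_{i:\,w_i\neq 0}|w_i|$. If $\|\mathbf{w}-\hat{\mathbf{w}}\|_2^2<\frac{q^2}{2}$, then $$\mathrm{support}(H_s(\hat{\mathbf{w}}))=\mathrm{support}(\mathbf{w}).$$
   Context: For $\mathbf{x}=[x_0,\dots,x_{N-1}]^T\in\mathbb{C}^N$, $\mathrm{support}(\mathbf{x})=\{i\in\{0,\dots,N-1\}: x_i\neq 0\}$ and $\|\mathbf{x}\|_0=|\mathrm{support}(\mathbf{x})|$ is the number of nonzero coefficients. Hard threshold operator: for a positive integer $s$, $H_s(\mathbf{x})$ is the vector obtained from $\mathbf{x}$ by keeping unchanged the coefficients with the $s$ largest absolute values and setting all others to zero. In case of ties, all tying coefficients are kept: $H_s(\mathbf{x})_i=x_i$ if $|x_i|$ is at least the $s$-th largest value (counted with multiplicity) among $|x_0|,\dots,|x_{N-1}|$, and $H_s(\mathbf{x})_i=0$ otherwise. For example, $H_2([2,-2,1,0]^T)=H_1([2,-2,1,0]^T)=[2,-2,0,0]^T$. *)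

(* Defs.v *)
From HB Require Import structures.
From mathcomp Require Import all_boot all_order all_algebra.
From mathcomp Require Import reals.
From mathcomp Require Import complex.

Set Implicit Arguments.
Unset Strict Implicit.
Unset Printing Implicit Defensive.

Import Order.TTheory GRing.Theory Num.Theory.
Local Open Scope ring_scope.

(* The order of R[i] is partial and its norm is R[i]-valued; moduli are taken
   in R, with ComplexField.Normc.normc, so that they can be sorted. *)
Definition cabs (R : realType) (z : R[i]) : R := ComplexField.Normc.normc z.

Definition supp (R : realType) (N : nat) (x : 'cV[R[i]]_N) : {set 'I_N} :=
  [set i | x i 0 != 0].

Definition norm0 (R : realType) (N : nat) (x : 'cV[R[i]]_N) : nat := #|supp x|.

Definition norm2 (R : realType) (N : nat) (x : 'cV[R[i]]_N) : R :=
  Num.sqrt (\sum_i cabs (x i 0) ^+ 2).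

(* Counted with multiplicity; meaningful for 1 <= s <= N.  For N < s the value
   is 0, so that thresholding at that level keeps every coefficient. *)
Definition nth_largest_abs (R : realType) (N : nat) (s : nat)
    (x : 'cV[R[i]]_N) : R :=
  nth 0 (sort >=%R [seq cabs (x i 0) | i <- enum 'I_N]) s.-1.

Definition hard_threshold (R : realType) (N : nat) (s : nat)
    (x : 'cV[R[i]]_N) : 'cV[R[i]]_N :=
  \col_i (if nth_largest_abs s x <= cabs (x i 0) then x i 0 else 0).

(* A relation, since the minimum is undefined for x = 0. *)
Definition is_min_abs_on_supp (R : realType) (N : nat)
    (x : 'cV[R[i]]_N) (q : R) : Prop :=
  (exists2 i : 'I_N, x i 0 != 0 & q = cabs (x i 0)) /\
  (forall i : 'I_N, x i 0 != 0 -> q <= cabs (x i 0)).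

(* Main.v *)
Require Import Defs.
From mathcomp Require Import all_boot all_order all_algebra.
From mathcomp Require Import reals.
From mathcomp Require Import complex.
From mathcomp Require Import lra.
Import Order.TTheory GRing.Theory Num.Theory.
Local Open Scope ring_scope.

(** Every coefficient of [what] on the support of [w] is strictly larger in modulus than every
    coefficient off it ([perturbation_separates]): swapping the order of just one pair would cost a
    squared error of at least [q ^+ 2 / 2]. As the support has exactly [s] elements, the [s]-th
    largest modulus then cuts precisely between the two groups, and no tie can cross the cut
    ([nth_largest_separated]). So thresholding keeps exactly the indices of [supp w], and
    [perturbation_supp_neq0] ensures that the kept coefficients do not vanish. *)

Section NthLargest.
Variables (R : realDomainType) (l : seq R) (k : nat).
Local Notation t := (nth 0 (sort >=%R l) k).

Let sorted_l i j : (i <= j < size l)%N ->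
  nth 0 (sort >=%R l) j <= nth 0 (sort >=%R l) i.
Proof.
move=> /andP[ij jl].
apply: (sorted_leq_nth (leT := >=%R)) => //.
- by move=> a b c ab bc; apply: le_trans bc ab.
- by move=> a; apply: lexx.
- by apply: sort_sorted => a b; rewrite orbC; apply: le_total.
- by rewrite inE size_sort (leq_ltn_trans ij).
- by rewrite inE size_sort.
Qed.

(** The first [k.+1] entries of the decreasing list are all at least its entry of index [k]. With
    the next bound, this is all that is used about sorting; ties are covered by the large and strict
    inequalities. *)
Lemma count_ge_nth_largest :
  (k < size l)%N -> (k < count (fun y => t <= y)%R l)%N.
Proof.
move=> k_lt; rewrite -(count_sort >=%R); set t0 := t.
rewrite -(cat_take_drop k.+1 (sort >=%R l)) count_cat.
have szt : size (take k.+1 (sort >=%R l)) = k.+1 by rewrite size_takel ?size_sort.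
apply: leq_trans (leq_addr _ _); rewrite -{1}szt; apply: eq_leq; apply/esym/eqP.
rewrite -all_count; apply/(all_nthP 0) => i; rewrite szt ltnS => ik.
by rewrite nth_take // sorted_l // ik.
Qed.

Lemma count_gt_nth_largest : (count (fun y => t < y)%R l <= k)%N.
Proof.
rewrite -(count_sort >=%R); set t0 := t.
rewrite -(cat_take_drop k (sort >=%R l)) count_cat.
rewrite [X in (_ + X)%N](_ : _ = 0%N); last first.
  apply/eqP; rewrite -leqn0 leqNgt -has_count -all_predC.
  apply/(all_nthP 0) => i; rewrite size_drop size_sort ltn_subRL => ki.
  by rewrite /= nth_drop -leNgt sorted_l // leq_addr.
by rewrite addn0 (leq_trans (count_size _ _)) // size_take_min geq_minl.
Qed.

End NthLargest.

Lemma count_map_enum (I : finType) (T : Type) (f : I -> T) (p : pred T) :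
  count p [seq f i | i <- enum I] = #|[set i | p (f i)]|.
Proof.
rewrite count_map enumT cardE size_filter.
by apply: eq_count => i; rewrite /= inE.
Qed.

Lemma nth_largest_separated (R : realDomainType) (I : finType) (f : I -> R)
    (A : {set I}) :
  (0 < #|A|)%N -> {in A & ~: A, forall i j, f j < f i} ->
  forall i, (nth 0 (sort >=%R [seq f i | i <- enum I]) #|A|.-1 <= f i)
            = (i \in A).
Proof.
move=> A_gt0 sepA i; set t := nth _ _ _.
have A_lt : (#|A|.-1 < size [seq f i | i <- enum I])%N.
  by rewrite prednK // size_map -cardE max_card.
have := count_gt_nth_largest R [seq f i | i <- enum I] #|A|.-1.
have := count_ge_nth_largest R _ _ A_lt.
rewrite !count_map_enum -/t prednK // => ge_t gt_t.
apply/idP/idP => [t_le | iA].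
  (* If an index outside [A] reached [t], all of [A] would lie strictly above [t], but at most
     [#|A|.-1] indices do. *)
  apply: contraTT gt_t => iNA; rewrite -ltnNge prednK //; apply: subset_leq_card.
  apply/subsetP => j jA; rewrite inE; apply: le_lt_trans t_le _.
  by apply: sepA; rewrite ?inE.
(* If [i] in [A] fell below [t], so would everything outside [A]; only indices of [A] other than [i]
   could reach [t], which is fewer than [#|A|]. *)
apply: contraTT ge_t; rewrite -ltNge -ltnNge => lt_t.
apply: proper_card; apply/properP; split; last by exists i; rewrite ?inE -?ltNge.
apply/subsetP => j; rewrite inE; apply: contraTT => jNA; rewrite -ltNge.
by apply: lt_trans lt_t; apply: sepA; rewrite ?inE.
Qed.

Section ComplexModulus.
Variable R : realType.
Implicit Types x y z : R[i].

(** Bridge that transfers facts about the [R[i]]-valued norm to the real modulus. *)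
Lemma cabsE z : (cabs z)%:C%C = `|z|.
Proof. by rewrite normc_def; case: z. Qed.

Lemma cabs_ge0 z : 0 <= cabs z.
Proof. by case: z => a b; apply: sqrtr_ge0. Qed.

Lemma cabs0 : cabs (0 : R[i]) = 0.
Proof. exact: ComplexField.Normc.normc0. Qed.

Lemma cabs_eq0 z : (cabs z == 0) = (z == 0).
Proof.
by apply/eqP/eqP => [/ComplexField.Normc.eq0_normc | ->] //; apply: cabs0.
Qed.

Lemma cabsN z : cabs (- z) = cabs z.
Proof. by apply: complexI; rewrite !cabsE normrN. Qed.

Lemma cabs_le_distD x y : cabs x <= cabs (x - y) + cabs y.
Proof. by rewrite -lecR rmorphD /= !cabsE -{1}(subrK y x) ler_normD. Qed.

End ComplexModulus.

Lemma norm2_sqr (R : realType) (N : nat) (x : 'cV[R[i]]_N) :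
  norm2 x ^+ 2 = \sum_i cabs (x i 0) ^+ 2.
Proof. by rewrite sqr_sqrtr // sumr_ge0 // => i _; apply: sqr_ge0. Qed.

Lemma cabs_sqr_le_norm2 (R : realType) (N : nat) (x : 'cV[R[i]]_N) i :
  cabs (x i 0) ^+ 2 <= norm2 x ^+ 2.
Proof.
rewrite norm2_sqr (bigD1 i) //= lerDl sumr_ge0 // => j _; exact: sqr_ge0.
Qed.

Lemma cabs_sqrD_le_norm2 (R : realType) (N : nat) (x : 'cV[R[i]]_N) i j :
  i != j -> cabs (x i 0) ^+ 2 + cabs (x j 0) ^+ 2 <= norm2 x ^+ 2.
Proof.
move=> ij; rewrite norm2_sqr (bigD1 i) //= (bigD1 j) 1?eq_sym //= addrA lerDl.
by rewrite sumr_ge0 // => m _; apply: sqr_ge0.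
Qed.

Section Perturbation.
Variables (R : realType) (N : nat) (w what : 'cV[R[i]]_N) (q : R).
Hypothesis q_min : is_min_abs_on_supp w q.
Hypothesis close : norm2 (w - what) ^+ 2 < q ^+ 2 / 2.

Let q_ge0 : 0 <= q.
Proof. by have [[i _ ->] _] := q_min; apply: cabs_ge0. Qed.

(** A zero of [what] at [i] would make the error there equal to [w i 0], of modulus at least [q]. *)
Lemma perturbation_supp_neq0 i : i \in supp w -> what i 0 != 0.
Proof.
rewrite inE => wi; apply/eqP => whati.
have := cabs_sqr_le_norm2 _ _ (w - what) i; rewrite !mxE whati subr0 => le_norm.
have q_le := q_min.2 i wi.
have : q ^+ 2 <= cabs (w i 0) ^+ 2 by rewrite ler_pXn2r ?nnegrE ?cabs_ge0.
have := sqr_ge0 q; move: close le_norm; lra.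
Qed.

(* If |what_i| <= |what_j|, then q <= |w_i - what_i| + |w_j - what_j|, so that
   q^2 / 2 is at most the sum of the squares of these two errors. *)
Lemma perturbation_separates :
  {in supp w & ~: supp w, forall i j, cabs (what j 0) < cabs (what i 0)}.
Proof.
move=> i j; rewrite !inE negbK => wi /eqP wj; rewrite ltNge; apply/negP => le_ij.
have ij : i != j by apply: contraNneq wi => ->; rewrite wj.
have := cabs_sqrD_le_norm2 _ _ (w - what) i j ij; rewrite !mxE wj sub0r cabsN.
have := cabs_le_distD _ (w i 0) (what i 0); have := q_min.2 i wi.
move: (cabs (what j 0)) (cabs (what i 0)) (cabs (w i 0 - what i 0)) le_ij.
move=> b c a le_cb q_le w_le le_norm.
have q_leD : q <= a + b by move: q_le w_le le_cb; lra.
have : q ^+ 2 <= (a + b) ^+ 2.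
  by rewrite ler_pXn2r ?nnegrE // (le_trans q_ge0).
(* Nonnegativity of [(a - b) ^+ 2] gives [(a + b) ^+ 2 <= 2 * (a ^+ 2 + b ^+ 2)], the source of the
   factor 2 in the hypothesis. *)
move: (sqr_ge0 (a - b)) close le_norm; rewrite sqrrB sqrrD; lra.
Qed.

End Perturbation.

Theorem theorem2 (R : realType) (N s : nat) (w what : 'cV[R[i]]_N) (q : R)
    (hs : (1 <= s)%N) (hw : norm0 w = s)
    (hq : is_min_abs_on_supp w q)
    (hclose : norm2 (w - what) ^+ 2 < q ^+ 2 / 2) :
  supp (hard_threshold s what) = supp w.
Proof.
apply/setP => i; rewrite inE mxE /nth_largest_abs -hw /norm0.
rewrite nth_largest_separated; last 2 first.
- by move: hs; rewrite -hw.
- exact: perturbation_separates hq hclose.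
by case: ifP => [/(perturbation_supp_neq0 _ _ _ _ _ hq hclose) | ]; rewrite ?eqxx.
Qed.
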